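(* Let $T=(V,E)$ be a combinatorial tree with $n=|V|\ge 2$ nodes and let $i\in V$. Then the Steinerberger curvature $\kappa^{\mathsf{s}}$ of $T$ is given by $$\kappa^{\mathsf{s}}_i=\frac{2n(2-\mathrm{d}(i))}{\operatorname{vol}(T)}=\frac{n}{n-1}\,(2-\mathrm{d}(i)).$$
   Context: A tree is a finite, simple, connected, acyclic graph; a combinatorial tree is a tree with all edge weights equal to one. Write $V=\{1,\dots,n\}$ and $\mathrm{d}(i)$ for the degree of $i$ (number of incident edges); since all weights are one, the volume is $\operatorname{vol}(T)=\sum_{i\in V}\mathrm{d}(i)$. $\Delta(i,j)$ is the shortest path distance (number of edges in a shortest path), and $\mathcal{D}\in\mathbb{R}^{n\times n}$ has entries $\mathcal{D}_{ij}=\Delta(i,j)$. The Steinerberger curvature is $\kappa^{\mathsf{s}}=\mathcal{D}^{+}(n\mathbf{1})\in\mathbb{R}^n$, where $\mathcal{D}^+$ is the Moore-Penrose inverse and $\mathbf{1}$ the all-ones vector; $\kappa^{\mathsf{s}}_i$ is its $i$-th entry. *)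

(* Defs.v *)
From mathcomp Require Import all_boot all_order all_algebra.
From mathcomp Require Import reals.
Set Implicit Arguments.
Unset Strict Implicit.
Unset Printing Implicit Defensive.
Import Order.TTheory GRing.Theory Num.Theory.
Local Open Scope ring_scope.

(* A simple graph on [V] is given by its adjacency relation. *)
Definition simple_graph (V : finType) (e : rel V) : Prop :=
  symmetric e /\ irreflexive e.

Definition connected_graph (V : finType) (e : rel V) : Prop :=
  forall x y : V, connect e x y.

(* [ucycleb e c] also accepts sequences of size at most 2 (a vertex, or an
   edge traversed back and forth); these are not cycles of a simple graph. *)
Definition acyclic_graph (V : finType) (e : rel V) : Prop :=
  forall c : seq V, (2 < size c)%N -> ~~ ucycleb e c.

Definition is_tree (V : finType) (e : rel V) : Prop :=
  [/\ simple_graph e, connected_graph e & acyclic_graph e].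

Definition degree (V : finType) (e : rel V) (x : V) : nat := #|[set y | e x y]|.

Definition volume (V : finType) (e : rel V) : nat :=
  (\sum_(x : V) degree e x)%N.

(* [x :: p] is a path (without repeated vertices) from [x] to [y];
   it has [size p] edges. *)
Definition graph_path (V : finType) (e : rel V) (x y : V) (p : seq V) : bool :=
  [&& path e x p, last x p == y & uniq (x :: p)].

(* Least number of edges of a path from [x] to [y].  Paths have fewer than
   [#|V|] edges, hence the range of the search; the value is [#|V|] when no
   path exists. *)
Definition graph_dist (V : finType) (e : rel V) (x y : V) : nat :=
  find (fun k => [exists p : k.-tuple V, graph_path e x y p]) (iota 0 #|V|).

Lemma graph_path_size (V : finType) (e : rel V) (x y : V) (p : seq V) :
  graph_path e x y p -> (size p < #|V|)%N.
Proof.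
by case/and3P=> _ _ /card_uniqP /= szp; rewrite -[(_ < _)%N]/((size p).+1 <= _)%N
  -szp max_card.
Qed.

Lemma graph_dist_min (V : finType) (e : rel V) (x y : V) (p : seq V) :
  graph_path e x y p -> (graph_dist e x y <= size p)%N.
Proof.
move=> ep; have ltp := graph_path_size ep; rewrite leqNgt; apply/negP=> lt.
have := before_find 0%N lt; rewrite nth_iota // add0n => /existsP[].
by exists (in_tuple p).
Qed.

Lemma graph_dist_path (V : finType) (e : rel V) (x y : V) :
  connect e x y -> exists2 p, graph_path e x y p & size p = graph_dist e x y.
Proof.
case/connectP=> q0 /shortenP[q eq uq _] ->.
have gq : graph_path e x (last x q) q by apply/and3P.
have ltd : (graph_dist e x (last x q) < #|V|)%N.
  exact: leq_ltn_trans (graph_dist_min gq) (graph_path_size gq).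
have hasd : has (fun k => [exists p : k.-tuple V, graph_path e x (last x q) p])
    (iota 0 #|V|) by rewrite has_find size_iota.
have := nth_find 0%N hasd; rewrite nth_iota // add0n => /existsP[p gp].
by exists p; rewrite ?size_tuple.
Qed.

(* The four Penrose equations for real matrices, stated over any real field:
   positivity of sums of squares suffices for existence and uniqueness. *)
Definition moore_penrose (R : realFieldType) (m n : nat)
    (A : 'M[R]_(m, n)) (B : 'M[R]_(n, m)) : bool :=
  [&& A *m B *m A == A, B *m A *m B == B,
      (A *m B)^T == A *m B & (B *m A)^T == B *m A].

Lemma row_free_gram (R : realFieldType) (m n : nat) (A : 'M[R]_(m, n)) :
  row_free A -> A *m A^T \in unitmx.
Proof.
move=> fA; rewrite -row_free_unit; apply: inj_row_free => v vAA0.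
apply: (row_free_inj fA); rewrite mul0mx; apply/matrixP => i j.
have /matrixP/(_ 0 0) : (v *m A) *m (v *m A)^T = 0.
  by rewrite trmx_mul mulmxA -[v *m A *m _]mulmxA vAA0 mul0mx.
rewrite !mxE => /eqP; under eq_bigr do rewrite [(_^T) _ _]mxE -expr2.
rewrite psumr_eq0 => [/allP/(_ j)|k _]; last exact: sqr_ge0.
by rewrite mem_index_enum sqrf_eq0 ord1 mxE => /(_ isT)/eqP.
Qed.

Lemma moore_penrose_exists (R : realFieldType) (m n : nat) (A : 'M[R]_(m, n)) :
  exists B, moore_penrose A B.
Proof.
have fD : row_free (row_base A) by exact: row_base_free.
have fC : row_free (col_base A)^T.
  by rewrite /row_free mxrank_tr; exact: col_base_full.
have AE := esym (mulmx_base A); move: fD fC AE.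
move: (\rank A) (col_base A) (row_base A) => r C D fD fC AE.
have uD : D *m D^T \in unitmx by exact: row_free_gram.
have uC : C^T *m C \in unitmx by have := row_free_gram fC; rewrite trmxK.
pose D' := D^T *m invmx (D *m D^T); pose C' := invmx (C^T *m C) *m C^T.
have DK : D *m D' = 1%:M by rewrite mulmxA mulmxV.
have CK : C' *m C = 1%:M by rewrite -mulmxA mulVmx.
have AB : A *m (D' *m C') = C *m C'.
  by rewrite AE mulmxA -[C *m D *m D']mulmxA DK mulmx1.
have BA : (D' *m C') *m A = D' *m D.
  by rewrite AE mulmxA -[D' *m C' *m C]mulmxA CK mulmx1.
exists (D' *m C'); apply/and4P; split; apply/eqP.
- by rewrite AB AE mulmxA -[C *m C' *m C]mulmxA CK mulmx1.
- by rewrite BA mulmxA -[D' *m D *m D']mulmxA DK mulmx1.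
- by rewrite AB /C' !trmx_mul trmx_inv trmx_mul trmxK mulmxA.
- by rewrite BA /D' !trmx_mul trmx_inv trmx_mul trmxK mulmxA.
Qed.

Lemma moore_penrose_uniq (R : realFieldType) (m n : nat) (A : 'M[R]_(m, n)) B C :
  moore_penrose A B -> moore_penrose A C -> B = C.
Proof.
case/and4P=> /eqP b1 /eqP b2 /eqP b3 /eqP b4.
case/and4P=> /eqP c1 /eqP c2 /eqP c3 /eqP c4.
have AA : A *m B = A *m C.
  by rewrite -{1}c1 -(mulmxA _ A B) -c3 -b3 -trmx_mul mulmxA b1.
have BB : B *m A = C *m A.
  by rewrite -{1}c1 -mulmxA mulmxA -b4 -c4 -trmx_mul -!mulmxA (mulmxA A) b1.
by rewrite -b2 -mulmxA AA mulmxA BB c2.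
Qed.

Definition mp_inverse (R : realFieldType) (m n : nat) (A : 'M[R]_(m, n)) :
    'M[R]_(n, m) :=
  xchoose (moore_penrose_exists A).

Lemma mp_inverseP (R : realFieldType) (m n : nat) (A : 'M[R]_(m, n)) :
  moore_penrose A (mp_inverse A).
Proof. exact: xchooseP. Qed.

Definition dist_matrix (R : realFieldType) (n : nat) (e : rel 'I_n) : 'M[R]_n :=
  \matrix_(i, j) (graph_dist e i j)%:R.

Definition steinerberger_curvature (R : realFieldType) (n : nat) (e : rel 'I_n) :
    'cV[R]_n :=
  mp_inverse (dist_matrix R e) *m const_mx n%:R.

(* Main.v *)
Require Import Defs.
From mathcomp Require Import all_boot all_order all_algebra.
From mathcomp Require Import reals ring.
Import Order.TTheory GRing.Theory Num.Theory.
Local Open Scope ring_scope.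

(** Fix a vertex [y] of a tree. Every vertex [x != y]
    has exactly one neighbour closer to [y], at distance [d(x, y) - 1], and all
    its other neighbours are at distance [d(x, y) + 1]
    ([tree_dist_neighbours]); this rests on the uniqueness of paths in a tree.
    Hence the sum over the neighbours [z] of [x] of [g (d(z, y))] is explicit
    for every function [g] ([sum_dist_neighbours]). With [tau x = 2 - deg x],
    this one formula is used three times:
    - pointwise, for [g] the identity, it says [L D = tau 1^T - 2 I], where
      [L] is the Laplacian and [D] the distance matrix;
    - summed over [x], for [g] the identity, it says that the degrees add up to
      [2 (n - 1)] ([tree_volume]), that is, [1^T tau = 2];
    - summed over [x], for [g] the square, it says [tau^T D = (n - 1) 1^T]
      ([sum_dist_defect]).

    Therefore [B = - L / 2 + tau tau^T / (2 (n - 1))] satisfies [B D = I]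
    (the formula of Graham and Lovasz). So [D] is invertible, its Moore-Penrose
    inverse is [B], and since [L 1 = 0] the curvature is
    [n B 1 = n tau (tau^T 1) / (2 (n - 1)) = n tau / (n - 1)]. *)

(** * Paths and distances in a tree *)

Section TreeDistance.

Variables (V : finType) (e : rel V).
Hypothesis tree_e : is_tree e.

Let e_sym : symmetric e. Proof. by case: tree_e => -[]. Qed.
Let e_irr : irreflexive e. Proof. by case: tree_e => -[]. Qed.

(** The graph with [x] isolated rather than deleted, so that no subtype of
    vertices is involved. *)
Definition avoid (x : V) : rel V := [rel u v | [&& e u v, u != x & v != x]].

Lemma avoid_connect_sym (x : V) : connect_sym (avoid x).
Proof.
by apply: sym_connect_sym => u v; rewrite /avoid /= e_sym [(u != x) && _]andbC.
Qed.

Lemma path_avoid (x a : V) (p : seq V) :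
  x \notin a :: p -> path e a p -> path (avoid x) a p.
Proof.
elim: p a => //= b p IHp a; rewrite inE negb_or => /andP[xa xbp] /andP[ab bp].
rewrite IHp // andbT /avoid /= ab eq_sym xa.
by apply: contra xbp => /eqP->; apply: mem_head.
Qed.

Lemma connect_avoid (x a b : V) (p : seq V) :
  x \notin a :: p -> path e a p -> b \in a :: p -> connect (avoid x) a b.
Proof. by move=> xp /(path_avoid _ _ _ xp) ap; apply: path_connect. Qed.

(** A path from [a] to [b] avoiding [x], made free of repetitions, closes up
    through [x] into a cycle of length at least 3 as soon as [a != b]. This is
    the form in which acyclicity is used below. *)
Lemma avoid_neighbours_eq (x a b : V) :
  e x a -> e x b -> connect (avoid x) a b -> a = b.
Proof.
move=> xa xb /connectP[q0 /shortenP[q aq uq _] def_b]; apply: contraTeq isT => neq_ab.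
have acyc : acyclic_graph e by case: tree_e.
have sub_q : subrel (avoid x) e by move=> u v /and3P[].
have xq : x \notin a :: q.
  rewrite inE negb_or; apply/andP; split.
    by apply: contraTneq xa => <-; rewrite e_irr.
  elim: (q) (a) aq => //= c r IHr d /andP[/and3P[_ _ cx] /IHr cr].
  by rewrite inE negb_or eq_sym cx.
have sz : (2 < size [:: x, a & q])%N.
  by case: q def_b {aq uq xq} => // ab; rewrite ab eqxx in neq_ab.
have := acyc _ sz; rewrite /ucycleb /cycle rcons_path /= xa (sub_path sub_q aq) /=.
by rewrite -def_b e_sym xb -/(uniq (a :: q)) uq xq.
Qed.

(** If the first steps [a] and [b] out of [x] were different, going from [a] to
    [y] along one path and back to [b] along the other would join two
    neighbours of [x] without visiting [x]. *)
Lemma graph_path_uniq (x y : V) (p q : seq V) :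
  graph_path e x y p -> graph_path e x y q -> p = q.
Proof.
elim: p x q => [|a p IHp] x [|b q] //=.
- case/and3P=> _ /eqP /= <- _ /and3P[_ /eqP /= lq /andP[]].
  by rewrite -[X in X \notin _]lq mem_last.
- case/and3P=> _ /eqP /= lp /andP[xp _] /and3P[_ /eqP /= xy _].
  by rewrite xy -lp mem_last in xp.
case/and3P=> /andP[xa ap] lp /andP[xp up] /and3P[/andP[xb bq] lq /andP[xq uq]].
have ab : a = b.
  apply: (avoid_neighbours_eq x) => //.
  apply: connect_trans (connect_avoid _ _ y _ xp ap _) _.
    by rewrite -(eqP lp) /= mem_last.
  rewrite avoid_connect_sym; apply: connect_avoid xq bq _.
  by rewrite -(eqP lq) /= mem_last.
rewrite ab in ap lp up *; congr (_ :: _); apply: (IHp b); exact/and3P.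
Qed.

Lemma tree_path_exists (x y : V) : exists p, graph_path e x y p.
Proof.
have conn_e : connected_graph e by case: tree_e.
by have [p xp _] := graph_dist_path (conn_e x y); exists p.
Qed.

Lemma tree_dist (x y : V) (p : seq V) :
  graph_path e x y p -> graph_dist e x y = size p.
Proof.
have conn_e : connected_graph e by case: tree_e.
have [q yq <-] := graph_dist_path (conn_e x y).
by move=> /graph_path_uniq /(_ yq) ->.
Qed.

Lemma tree_dist_refl (x : V) : graph_dist e x x = 0%N.
Proof. by rewrite (tree_dist x x [::]) // /graph_path /= eqxx. Qed.

Lemma tree_dist_adj (x z : V) : e x z -> graph_dist e z x = 1%N.
Proof.
move=> xz; rewrite (tree_dist z x [:: x]) // /graph_path /= e_sym xz eqxx inE.
by rewrite !andbT /=; apply: contraTneq xz => ->; rewrite e_irr.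
Qed.

(** The closer neighbour [a] is the first step of the path [x :: a :: p] to
    [y]. Another neighbour [z] of [x] is not on that path, since the path would
    join [a] to [z] while avoiding [x]; so [z :: x :: a :: p] is again a path,
    and paths of a tree realize the distance. *)
Lemma tree_dist_neighbours (x y : V) : x != y ->
  exists a, [/\ e x a, graph_dist e x y = (graph_dist e a y).+1 &
    forall z, e x z -> z != a -> graph_dist e z y = (graph_dist e x y).+1].
Proof.
have [[|a p] xyp] := tree_path_exists x y.
  by case/and3P: xyp => _ /= ->.
move=> _; have dx := tree_dist _ _ _ xyp.
case/and3P: (xyp) => /andP[xa ap] lp /andP[xp up].
exists a; split=> // [|z xz za].
  by rewrite dx (tree_dist a y p) //; apply/and3P.
rewrite dx (tree_dist z y [:: x, a & p]) //; apply/and3P; split=> //.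
  by rewrite /= e_sym xz xa.
have upx : uniq [:: x, a & p] by case/and3P: xyp.
rewrite cons_uniq upx inE negb_or andbT; apply/andP; split.
  by apply: contraTneq xz => ->; rewrite e_irr.
apply: contra za => /(connect_avoid x a z p xp ap) az.
by rewrite eq_sym; apply/eqP/(avoid_neighbours_eq x).
Qed.

(** All neighbours of [x] count as farther from [y] in the first term; the
    second one corrects the closer neighbour, which exists unless [x = y]. *)
Lemma sum_dist_neighbours (M : zmodType) (g : nat -> M) (x y : V) :
  \sum_(z | e x z) g (graph_dist e z y) =
  g (graph_dist e x y).+1 *+ degree e x +
  (g (graph_dist e x y).-1 - g (graph_dist e x y).+1) *+ (x != y).
Proof.
have degE : degree e x = #|[pred z | e x z]| by rewrite /degree cardsE.
have [<-|xy] := eqVneq x y.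
  rewrite tree_dist_refl addr0 degE -sumr_const.
  by apply: eq_bigr => z xz; rewrite tree_dist_adj.
have [a [xa dx dz]] := tree_dist_neighbours _ _ xy.
rewrite degE -sumr_const (bigD1 a) //= [in RHS](bigD1 a) //= mulr1n.
rewrite [RHS]addrAC subrKC; congr (_ + _); first by rewrite dx.
by apply: eq_bigr => z /andP[xz za]; rewrite dz.
Qed.

Lemma sum_neighbours (M : zmodType) (f : V -> M) :
  \sum_x \sum_(z | e x z) f z = \sum_x f x *+ degree e x.
Proof.
rewrite (exchange_big_dep predT) //=; apply: eq_bigr => z _.
rewrite sumr_const; congr (_ *+ _); rewrite /degree cardsE.
by apply: eq_card => x; rewrite unfold_in /= e_sym.
Qed.

(** The previous formula summed over [x]: by double counting, the total over
    all neighbours is [g (d(x, y))] weighted by the degree of [x]. Choosing [g]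
    yields all the global identities needed on degrees and distances. *)
Lemma sum_dist_degree (M : zmodType) (g : nat -> M) (y : V) :
  \sum_x (g (graph_dist e x y).+1 - g (graph_dist e x y)) *+ degree e x =
  \sum_(x | x != y) (g (graph_dist e x y).+1 - g (graph_dist e x y).-1).
Proof.
have := sum_neighbours M (fun z => g (graph_dist e z y)).
under eq_bigr do rewrite sum_dist_neighbours.
rewrite big_split /= => gE; under eq_bigr do rewrite mulrnBl.
rewrite sumrB -gE opprD addNKr -sumrN big_mkcond [RHS]big_mkcond /=.
by apply: eq_bigr => x _; case: ifP; rewrite ?oppr0 // mulr1n opprB.
Qed.

Lemma tree_dist_gt0 (x y : V) : x != y -> (0 < graph_dist e x y)%N.
Proof. by case/tree_dist_neighbours=> a [_ ->]. Qed.

(** For [g] the identity both differences are constant, namely 1 and 2; so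
    the number of edges of a tree comes out without an induction on trees. *)
Lemma tree_volume (R : comRingType) (y : V) :
  (volume e)%:R = 2 * (#|V|%:R - 1) :> R.
Proof.
have := sum_dist_degree R (fun k => k%:R) y.
under eq_bigr do rewrite -natr1 addrAC subrr add0r.
rewrite -natr_sum => ->.
rewrite (eq_bigr (fun=> 2)) => [|x /tree_dist_gt0]; last first.
  by case: graph_dist => //= k _; ring.
by rewrite sumr_const (cardC1 y) -[LHS]mulr_natr -subn1 natrB //; apply/card_gt0P; exists y.
Qed.

(** For [g] the square, the differences are [2 d + 1] and [4 d], so
    the sum of [(4 - 2 deg x) d(x, y)] is the volume [2 (n - 1)]. *)
Lemma sum_dist_defect (R : numDomainType) (y : V) :
  \sum_x (2 - (degree e x)%:R) * (graph_dist e x y)%:R = #|V|%:R - 1 :> R.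
Proof.
have := sum_dist_degree R (fun k => k%:R ^+ 2) y.
set d := graph_dist e; set dg := degree e => sqE.
have two_neq0 : (2 : R) != 0 by rewrite pnatr_eq0.
apply: (mulfI two_neq0); rewrite -tree_volume // /volume natr_sum -/dg.
(* The term [x = y] may be restored on the right because [d(y, y) = 0]. *)
have {}sqE : \sum_x (2 * (d x y)%:R + 1) * (dg x)%:R
           = \sum_x 4 * (d x y)%:R :> R.
  transitivity (\sum_x ((d x y).+1%:R ^+ 2 - (d x y)%:R ^+ 2) *+ dg x : R).
    by apply: eq_bigr => x _; rewrite -[in RHS]mulr_natr; congr (_ * _); ring.
  rewrite sqE [RHS](bigD1 y) //= /d tree_dist_refl mulr0 add0r.
  apply: eq_bigr => x /tree_dist_gt0.
  by case: graph_dist => //= k _; ring.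
rewrite mulr_sumr; apply/eqP; rewrite -subr_eq0 -sumrB; apply/eqP.
rewrite -[RHS](subrr (\sum_x 4 * (d x y)%:R)) -{2}sqE -sumrB.
by apply: eq_bigr => x _; ring.
Qed.

End TreeDistance.

(** * The inverse of the distance matrix *)

Definition defect (R : realFieldType) (n : nat) (e : rel 'I_n) : 'cV[R]_n :=
  \col_i (2 - (degree e i)%:R).

Definition laplacian (R : realFieldType) (n : nat) (e : rel 'I_n) : 'M[R]_n :=
  \matrix_(i, j) ((degree e i)%:R *+ (i == j) - (e i j)%:R).

Lemma laplacian_mulE (R : realFieldType) (n : nat) (e : rel 'I_n) m
    (A : 'M[R]_(n, m)) i j :
  (laplacian R n e *m A) i j = (degree e i)%:R * A i j - \sum_(k | e i k) A k j.
Proof.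
rewrite mxE; under eq_bigr do rewrite mxE mulrBl.
rewrite sumrB; congr (_ - _).
  rewrite (bigD1 i) //= eqxx mulr1n big1 ?addr0 // => k ki.
  by rewrite eq_sym (negPf ki) mul0r.
rewrite [RHS]big_mkcond; apply: eq_bigr => k _.
by case: (e i k); rewrite ?mul1r ?mul0r.
Qed.

Section TreeMatrices.

Variables (R : realFieldType) (n : nat) (e : rel 'I_n).
Hypotheses (n_ge2 : (2 <= n)%N) (tree_e : is_tree e).

Local Notation L := (laplacian R n e).
Local Notation D := (dist_matrix R e).
Local Notation tau := (defect R n e).

(** Off the diagonal, [deg i] neighbours at distance [d + 1], one of them
    corrected to [d - 1], give [deg i * d - deg i * (d + 1) + 2]. *)
Lemma laplacian_dist : L *m D = tau *m const_mx 1 - 2%:M.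
Proof.
apply/matrixP=> i j; rewrite laplacian_mulE !mxE big_ord1 !mxE.
under eq_bigr do rewrite mxE.
rewrite (sum_dist_neighbours _ e tree_e R (fun k => k%:R)) mulr1.
have [<-|ij] := eqVneq i j; first by rewrite tree_dist_refl //=; ring.
by case: graph_dist (tree_dist_gt0 _ e tree_e _ _ ij) => //= k _; ring.
Qed.

Lemma defect_dist : tau^T *m D = const_mx (n%:R - 1).
Proof.
apply/matrixP=> i j; rewrite !mxE; under eq_bigr do rewrite !mxE.
by rewrite sum_dist_defect // card_ord.
Qed.

Lemma laplacian_const (c : R) : L *m const_mx c = 0 :> 'cV_n.
Proof.
apply/matrixP=> i j; rewrite laplacian_mulE !mxE.
under eq_bigr do rewrite mxE.
by rewrite sumr_const mulr_natl /degree cardsE subrr.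
Qed.

Lemma defect_const (c : R) : tau^T *m const_mx c = (2 * c)%:M.
Proof.
apply/matrixP=> i j; rewrite !ord1 mxE; under eq_bigr do rewrite !mxE.
have y : 'I_n := Ordinal (ltnW n_ge2).
rewrite -mulr_suml sumrB sumr_const card_ord -natr_sum.
by rewrite -/(volume e) (tree_volume _ e tree_e _ y) card_ord mxE eqxx mulr1n -(mulr_natr _ n); ring.
Qed.

(** The Graham-Lovasz inverse. The Laplacian term alone gives
    [(- L / 2) D = I - tau 1^T / 2]; since [tau^T D] is a multiple of [1^T],
    the rank one term can cancel the remainder. *)
Definition dist_inverse : 'M[R]_n :=
  (2 * (n%:R - 1))^-1 *: (tau *m tau^T) - 2^-1 *: L.

Let n1_neq0 : n%:R - 1 != 0 :> R.
Proof. by rewrite subr_eq0 pnatr_eq1; case: n n_ge2 => [|[]]. Qed.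

Lemma dist_inverseP : dist_inverse *m D = 1%:M.
Proof.
rewrite mulmxBl -!scalemxAl -mulmxA defect_dist laplacian_dist.
apply/matrixP=> i j; rewrite !mxE !big_ord1 !mxE -[RHS]mulr_natl.
by case: (i == j); field; rewrite n1_neq0.
Qed.

Lemma dist_inverse_const (c : R) :
  dist_inverse *m const_mx c = (c / (n%:R - 1)) *: tau.
Proof.
rewrite mulmxBl -!scalemxAl -mulmxA defect_const laplacian_const scaler0 subr0.
rewrite mul_mx_scalar scalerA; congr (_ *: _).
by field; rewrite n1_neq0.
Qed.

End TreeMatrices.

Lemma mp_inverse_eq (R : realFieldType) (n : nat) (A B : 'M[R]_n) :
  B *m A = 1%:M -> mp_inverse A = B.
Proof.
move=> BA; have AB := mulmx1C BA.
apply: (moore_penrose_uniq (mp_inverseP A)); apply/and4P.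
by rewrite AB BA !mul1mx trmx1 !eqxx.
Qed.

Theorem corollary4p2 (R : realType) (n : nat) (e : rel 'I_n) (i : 'I_n)
    (n_ge2 : (2 <= n)%N) (tree_e : is_tree e) :
  steinerberger_curvature R e i 0
    = (2 * n%:R * (2 - (degree e i)%:R)) / (volume e)%:R :> R /\
  (2 * n%:R * (2 - (degree e i)%:R)) / (volume e)%:R
    = n%:R / (n%:R - 1) * (2 - (degree e i)%:R) :> R.
Proof.
have n1_neq0 : n%:R - 1 != 0 :> R.
  by rewrite subr_eq0 pnatr_eq1; case: n n_ge2 {e i tree_e} => [|[]].
have volE : (2 * n%:R * (2 - (degree e i)%:R)) / (volume e)%:R
    = n%:R / (n%:R - 1) * (2 - (degree e i)%:R) :> R.
  by rewrite (tree_volume _ e tree_e _ i) card_ord; field; rewrite n1_neq0.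
split=> //; rewrite volE /steinerberger_curvature.
rewrite (mp_inverse_eq _ _ _ _ (dist_inverseP R n e n_ge2 tree_e)).
by rewrite dist_inverse_const // !mxE.
Qed.
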